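(* Let $G=(V,E)$ be a finite undirected graph with $n$ vertices and positive edge weights, let $\varepsilon>0$, and let $\overrightarrow{G}$ be an $\eta$-fair fractional orientation of $G$ with $\eta\le\frac{\varepsilon^2}{128\log n}$. Then for every $v\in V$, \[(1+\varepsilon)^{-1}\rho^*(v)\le \textsl{g}(v)\le(1+\varepsilon)\rho^*(v),\] where $\textsl{g}(v)$ is the out-degree of $v$ in $\overrightarrow{G}$.
   Context: A fractional orientation assigns to each edge $\overline{uv}$ nonnegative reals $\textsl{g}(u\to v),\textsl{g}(v\to u)$ summing to the edge weight $\textsl{g}(\overline{uv})$; out-degree $\textsl{g}(u)=\sum_v\textsl{g}(u\to v)$. It is $\eta$-fair ($\eta>0$) if $\textsl{g}(u\to v)>0$ implies $\textsl{g}(u)\le(1+\eta)\textsl{g}(v)$. Local density: for $B\subseteq V$ and nonempty $X\subseteq V\setminus B$, let $\hat E_B(X)$ be the set of edges with one endpoint in $X$ and the other in $X\cup B$, and $\hat\rho_B(X)=\frac{1}{|X|}\sum_{e\in\hat E_B(X)}\textsl{g}(e)$. Define $B_0=\emptyset$ and, while $B_{i-1}\neq V$, let $S_i$ be a (inclusion-wise largest) maximizer of $\hat\rho_{B_{i-1}}(X)$ over nonempty $X\subseteq V\setminus B_{i-1}$, and $B_i=B_{i-1}\cup S_i$. For $v\in S_i$, the local density is $\rho^*(v)=\hat\rho_{B_{i-1}}(S_i)$.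
   Formalization: The formal theorem assumes ε ≤ 1: for very large ε the claim fails (one edge of weight 1, n = 2, η = ε²/(128 ln 2), ε > 256 ln 2). The logarithm is natural, and the bound on η is required only for n ≥ 2. *)

(* Defs.v *)
From mathcomp Require Import all_boot all_order all_algebra.
From mathcomp Require Import reals exp.

Set Implicit Arguments.
Unset Strict Implicit.
Unset Printing Implicit Defensive.

Import Order.TTheory GRing.Theory Num.Theory.
Local Open Scope ring_scope.

(* Edges are two-element vertex sets, so the graph is simple; [weight] is
   meaningful on [edges] only. *)
Record wgraph (R : realType) (V : finType) := WGraph {
  edges : {set {set V}};
  weight : {set V} -> R;
  card_edge : forall e, e \in edges -> #|e| = 2%N;
  weight_gt0 : forall e, e \in edges -> 0 < weight e
}.

Section LocalDensity.

Variables (R : realType) (V : finType) (G : wgraph R V).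

Definition local_edges (B X : {set V}) : {set {set V}} :=
  [set e in edges G | [exists x in X, exists y in X :|: B, e == [set x; y]]].

Definition local_rho (B X : {set V}) : R :=
  (\sum_(e in local_edges B X) weight G e) / #|X|%:R.

Definition candidate (B X : {set V}) : bool := (X != set0) && (X \subset ~: B).

Definition maximizer (B X : {set V}) : bool :=
  candidate B X && [forall Y, candidate B Y ==> (local_rho B Y <= local_rho B X)].

(* The inclusion-wise largest maximizer: maximizers are closed under union, so
   only one is inclusion-maximal. The default [set0] occurs only for [B] = V. *)
Definition densest (B : {set V}) : {set V} :=
  odflt set0 [pick X | maxset (maximizer B) X].

(* [below i] is B_i and [layer i] is S_(i+1): layers are numbered from 0. *)
Definition below (i : nat) : {set V} := iter i (fun B => B :|: densest B) set0.
Definition layer (i : nat) : {set V} := densest (below i).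

Lemma densestP (B : {set V}) : B != setT -> maxset (maximizer B) (densest B).
Proof.
move=> BT; rewrite /densest; case: pickP => //= noX.
have BC0 : candidate B (~: B).
  by rewrite /candidate subxx andbT -setCT (inj_eq (can_inj (@setCK V))).
pose X := [arg max_(X > ~: B | candidate B X) local_rho B X]%O.
have mX : maximizer B X.
  rewrite /X; case: Order.TotalTheory.arg_maxP => // Y cY maxY.
  by rewrite /maximizer cY; apply/forallP => Z; apply/implyP => /maxY.
by have [Y mY _] := maxset_exists mX; have := noX Y; rewrite mY.
Qed.

Lemma densest_sub (B : {set V}) : densest B \subset ~: B.
Proof.
rewrite /densest; case: pickP => [X|_] /=; last exact: sub0set.
by move/maxsetp => /andP[/andP[]].
Qed.

Lemma belowS i : below i.+1 = below i :|: layer i. Proof. by []. Qed.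

Lemma below_mono i j : (i <= j)%N -> below i \subset below j.
Proof.
elim: j => [|j IHj]; first by rewrite leqn0 => /eqP ->.
rewrite leq_eqVlt => /orP[/eqP -> //|/IHj sij].
by rewrite belowS (subset_trans sij) ?subsetUl.
Qed.

Lemma below_full : below #|V| = setT.
Proof.
suff H i : (below i == setT) || (i <= #|below i|)%N.
  have /orP[/eqP //|] := H #|V|; rewrite -cardsT => h.
  by apply/eqP; rewrite eqEcard subsetT.
elim: i => [|i IHi]; first by rewrite orbT.
have [BT|BnT] := eqVneq (below i) setT.
  by rewrite belowS BT setTU eqxx.
rewrite (negPf BnT) orFb in IHi.
have /andP[/andP[S0 SB] _] := maxsetp (densestP BnT).
rewrite belowS cardsU disjoint_setI0 ?cards0 ?subn0; last first.
  by rewrite disjoint_sym disjoints_subset; exact: SB.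
by apply/orP; right; rewrite -addn1 leq_add // card_gt0.
Qed.

Lemma layer_cover (v : V) : exists i, v \in layer i.
Proof.
have : v \in below #|V| by rewrite below_full inE.
elim: #|V| => [|i IHi]; first by rewrite inE.
by rewrite belowS inE => /orP[/IHi //|]; exists i.
Qed.

Definition level (v : V) : nat := ex_minn (layer_cover v).

Definition local_density (v : V) : R :=
  local_rho (below (level v)) (layer (level v)).

(* The layers are disjoint, so [level] involves no choice. *)
Lemma levelE (v : V) (i : nat) : v \in layer i -> level v = i.
Proof.
rewrite /level; case: ex_minnP => j vj minj vi.
apply/eqP; rewrite eqn_leq minj //= leqNgt; apply/negP => ji.
have /subsetP/(_ v) := below_mono ji; rewrite belowS inE vj orbT => /(_ isT) vB.
by have /subsetP/(_ v vi) := densest_sub (below i); rewrite inE vB.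
Qed.

End LocalDensity.

(* [o u v] is the part of the weight of the edge uv oriented from u to v;
   it is meaningful on edges only. *)
Definition fractional_orientation (R : realType) (V : finType)
    (G : wgraph R V) (o : V -> V -> R) : Prop :=
  forall u v, [set u; v] \in edges G ->
    0 <= o u v /\ o u v + o v u = weight G [set u; v].

Definition outdeg (R : realType) (V : finType)
    (G : wgraph R V) (o : V -> V -> R) (u : V) : R :=
  \sum_(v | [set u; v] \in edges G) o u v.

Definition fair (R : realType) (V : finType)
    (G : wgraph R V) (o : V -> V -> R) (eta : R) : Prop :=
  forall u v, [set u; v] \in edges G ->
    0 < o u v -> outdeg G o u <= (1 + eta) * outdeg G o v.

(* Main.v *)
(** Fix a vertex v with local density r, and let g be the out-degree.

    Upper bound: put B := below (level v) and let T_i be the set of vertices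
    outside B with g v <= (1 + eta)^i * g. By fairness, the weight leaving T_i
    ends in B or in T_(i+1), so maximality of r gives
    |T_i| * g v <= (1 + eta)^i * r * |T_(i+1)|.

    Lower bound: put D := below (level v).+1 and let U_i be the set of vertices
    of D with g <= (1 + eta)^i * g v. Since no set of vertices can be removed
    from a layer to increase its density, and densities decrease with the
    layers, the edges inside D that meet U_i have weight at least r * |U_i|. By
    fairness this weight leaves vertices of U_(i+1), hence
    r * |U_i| <= (1 + eta)^(i+1) * g v * |U_(i+1)|.

    As sizes are bounded by n, in both cases some i = O(log n / eps) satisfies
    |X_(i+1)| <= (1 + eps / 4) * |X_i|, and (1 + eta)^(i+1) is then at most
    (1 + eps) / (1 + eps / 4). *)

Require Import Defs.
From mathcomp Require Import all_boot all_order all_algebra.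
From mathcomp Require Import reals exp.
From mathcomp Require Import ring lra.
Import Order.TTheory GRing.Theory Num.Theory.
Local Open Scope ring_scope.

(** * Growth of bounded sequences, with explicit constants *)

(** Otherwise [f] would grow by a factor above [1 + d] at each of the first [k] steps, starting from
    at least 1, and would exceed [n]. *)
Lemma slow_growth_step {R : realType} (d : R) (n k : nat) (f : nat -> nat) :
  0 <= d -> (0 < k)%N -> n%:R <= (1 + d) ^+ k ->
  (0 < f 0)%N -> (forall i, f i <= n)%N ->
  exists2 i, (i < k)%N & (f i.+1)%:R <= (1 + d) * (f i)%:R.
Proof.
move=> d0 k0 nk f0 fn.
have [/existsP[i Hi]|/existsPn H] :=
    boolP [exists i : 'I_k, (f i.+1)%:R <= (1 + d) * (f i)%:R].
  by exists (i : nat).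
have grow j : (j < k)%N -> (1 + d) ^+ j.+1 < (f j.+1)%:R.
  elim: j => [|j IHj] jk; have := H (Ordinal jk); rewrite -ltNge; apply: le_lt_trans.
    by rewrite expr1 ler_peMr ?ler1n //; lra.
  by rewrite exprS ler_wpM2l ?(ltW (IHj (ltnW jk))) //; lra.
have := grow k.-1; rewrite prednK // => /(_ (leqnn _)) lt_k.
have := lt_le_trans (le_lt_trans nk lt_k) (_ : _ <= n%:R).
by rewrite ltxx ler_nat fn => /(_ isT).
Qed.

(** A division-free upper bound on [(1 + x) ^+ k], of interest when [k * x < 1]. The induction rests
    on [(1 + x) * (1 - (k + 1) * x) <= 1 - k * x]. *)
Lemma expr1D_le {R : realType} (x : R) (k : nat) :
  0 <= x -> (1 + x) ^+ k * (1 - k%:R * x) <= 1.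
Proof.
move=> x0; elim: k => [|k IHk]; first by rewrite expr0; lra.
apply: le_trans IHk; rewrite exprSr -mulrA ler_wpM2l ?exprn_ge0 //; first lra.
have : 0 <= k%:R * x by rewrite mulr_ge0.
by rewrite -natr1; nra.
Qed.

(** The exponent is the first integer above [ln n / ln (1 + eps / 4)]. The bound on [eta] then keeps
    [k * eta] below [eps / 16], so that [(1 + eta) ^+ k] is at most [1 / (1 - eps / 16)]. *)
Lemma exists_exponent {R : realType} (eps eta : R) (n : nat) :
  0 < eps -> eps <= 1 -> 0 < eta -> (1 < n)%N ->
  eta <= eps ^+ 2 / (128%:R * ln n%:R) ->
  exists k, [/\ (0 < k)%N, n%:R <= (1 + eps / 4%:R) ^+ k
              & (1 + eps / 4%:R) * (1 + eta) ^+ k <= 1 + eps].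
Proof.
move=> e0 e1 h0 n1 hle.
have n0 : 0 < n%:R :> R by rewrite ltr0n (ltn_trans _ n1).
(* This is [ln (1 + y) <= y] at [y = x^-1 - 1]. *)
have ln_lower (x : R) : 0 < x -> 1 - x^-1 <= ln x.
  move=> x0; have : -1 < x^-1 - 1 by rewrite ltrBrDr addNr invr_gt0.
  by move=> /le_ln1Dx; rewrite addrCA subrr addr0 lnV ?posrE //; lra.
have Ln : 2^-1 <= ln (n%:R : R).
  apply: le_trans (_ : 1 - n%:R^-1 <= _); last exact: ln_lower.
  have : n%:R^-1 <= 2^-1 :> R by rewrite lef_pV2 ?posrE ?ler_nat //.
  by lra.
have Ld : eps / 5%:R <= ln (1 + eps / 4%:R).
  apply: le_trans (ln_lower _ _); last by lra.
  have -> : 1 - (1 + eps / 4%:R)^-1 = eps / (4%:R + eps) by field; lra.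
  by rewrite ler_pM2l // lef_pV2 ?posrE; lra.
set L := ln n%:R in Ln hle *; set l := ln _ in Ld.
have l0 : 0 < l by lra.
have x0 : 0 <= L / l by rewrite divr_ge0; lra.
have /andP[kle klt] := truncn_itv x0.
exists (Num.truncn (L / l)).+1; set k := Num.truncn _ in kle klt *.
split => //.
  rewrite -ler_ln ?posrE ?exprn_gt0 //; try lra.
  by rewrite lnXn ?posrE -/L -/l; [rewrite -mulr_natl -ler_pdivrMr // ltW|lra].
(* From [k * eps <= 5 * L] comes [k * eta <= 5 * eps / 128]. Rounding up costs one more [eta], at
   most [eps / 64] because [L >= 1 / 2]. The sum is [7 * eps / 128]. *)
have kh : k.+1%:R * eta <= eps / 16%:R.
  have hL : eta * (128%:R * L) <= eps ^+ 2 by rewrite -ler_pdivlMr //; lra.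
  have kL : k%:R * l <= L by rewrite -ler_pdivlMr.
  have k0 : 0 <= k%:R :> R by [].
  have kL5 : k%:R * eps <= 5%:R * L by nra.
  have hh : eta * 64%:R <= eps ^+ 2 by nra.
  have h1 : 0 <= eta * (5%:R * L - k%:R * eps) by rewrite mulr_ge0; lra.
  have h2 : 128%:R * (eta * (k%:R * eps)) <= 5%:R * eps ^+ 2 by nra.
  rewrite -natr1 -(ler_pM2r e0); nra.
have := @expr1D_le R eta k.+1 (ltW h0).
set p := (1 + eta) ^+ _ => hp.
have p0 : 0 < p by rewrite exprn_gt0; lra.
have : p * (1 - eps / 16%:R) <= 1 by apply: le_trans hp; rewrite ler_pM2l //; lra.
nra.
Qed.

(** The slow step occurs at some [i < k], so [(1 + eta) ^+ i.+1] is at most the power controlled by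
    the choice of [k]. *)
Lemma slow_growth {R : realType} (eps eta : R) (n : nat) (f : nat -> nat) :
  0 < eps -> eps <= 1 -> 0 < eta -> (1 < n)%N ->
  eta <= eps ^+ 2 / (128%:R * ln n%:R) ->
  (0 < f 0)%N -> (forall i, f i <= n)%N ->
  exists i, (f i.+1)%:R * (1 + eta) ^+ i.+1 <= (1 + eps) * (f i)%:R.
Proof.
move=> e0 e1 h0 n1 hle f0 fn.
have [k [k0 nk hk]] := exists_exponent _ _ _ e0 e1 h0 n1 hle.
have [|i ik fi] := slow_growth_step _ _ _ _ _ k0 nk f0 fn; first by lra.
exists i.
apply: le_trans (_ : (1 + eps / 4%:R) * (f i)%:R * (1 + eta) ^+ k <= _).
  apply: ler_pM => //; first by rewrite exprn_ge0; lra.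
  by rewrite ler_weXn2l //; lra.
by rewrite mulrAC ler_wpM2r.
Qed.

(** * Edge weights and the densities of the layers *)

(** Keeping [D] independent of [X] covers both the edges counted by [local_rho] (with [D = X :|: B])
    and those lost when [X] is removed from [D]. *)
Definition touching {R : realType} {V : finType} (G : wgraph R V)
    (D X : {set V}) : {set {set V}} :=
  [set e in edges G | (e \subset D) && ~~ [disjoint e & X]].

Definition total_weight {R : realType} {V : finType} (G : wgraph R V)
    (F : {set {set V}}) : R := \sum_(e in F) weight G e.

Lemma local_edgesE {R : realType} {V : finType} (G : wgraph R V) (B X : {set V}) :
  local_edges G B X = touching G (X :|: B) X.
Proof.
apply/setP => e; rewrite !inE; case eG : (e \in edges G) => //=.
apply/exists_inP/andP => [[x xX /exists_inP[y yXB /eqP ->]]|[eD eX]].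
  split; last by apply/pred0Pn; exists x; rewrite /= set21 xX.
  by rewrite subUset !sub1set yXB inE xX.
case/pred0Pn: eX => x /andP[/= xe xX].
have /cards2P[a [b [ab Ee]]] := introT eqP (card_edge eG).
exists x => //; apply/exists_inP; subst e.
move: eD; rewrite subUset !sub1set => /andP[aD bD].
move: xe; rewrite !inE => /orP[]/eqP ->; first by exists b.
by exists a => //; rewrite setUC.
Qed.

Lemma total_weight_sub {R : realType} {V : finType} (G : wgraph R V)
    (F F' : {set {set V}}) :
  F \subset F' -> F' \subset edges G -> total_weight G F <= total_weight G F'.
Proof.
move=> /subsetP FF' /subsetP F'E; rewrite /total_weight.
rewrite [leRHS](big_setID F) /= (setIidPr _); last exact/subsetP.
rewrite lerDl sumr_ge0 // => e; rewrite inE => /andP[_ /F'E eE].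
exact: ltW (weight_gt0 eE).
Qed.

Lemma total_weightU {R : realType} {V : finType} (G : wgraph R V)
    (F F' : {set {set V}}) :
  [disjoint F & F'] -> total_weight G (F :|: F') = total_weight G F + total_weight G F'.
Proof. by move=> dF; rewrite /total_weight -bigU //; apply: eq_bigl => e; rewrite !inE. Qed.

Lemma touching_edges {R : realType} {V : finType} (G : wgraph R V) (D X : {set V}) :
  touching G D X \subset edges G.
Proof. by apply/subsetP => e; rewrite inE => /andP[]. Qed.

Lemma touching0 {R : realType} {V : finType} (G : wgraph R V) (D : {set V}) :
  touching G D set0 = set0.
Proof. by apply/setP => e; rewrite !inE -setI_eq0 setI0 eqxx !andbF. Qed.

(** An edge inside [D] cannot meet [X'], so no edge is counted twice on the left. *)
Lemma touching_setU {R : realType} {V : finType} (G : wgraph R V)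
    (D D' X X' : {set V}) :
  D \subset D' -> [disjoint D & X'] ->
  total_weight G (touching G D X) + total_weight G (touching G D' X')
    <= total_weight G (touching G D' (X :|: X')).
Proof.
move=> DD' DX'; rewrite -total_weightU.
  apply: total_weight_sub; last exact: touching_edges.
  apply/subsetP => e; rewrite !inE => /orP[]/and3P[-> eD eX] /=.
    rewrite (subset_trans eD) //=; apply: contra eX => /disjointWr; apply; exact: subsetUl.
  by rewrite eD; apply: contra eX => /disjointWr; apply; exact: subsetUr.
apply/pred0P => e /=; rewrite !inE; apply/negP => /andP[/and3P[_ eD _] /and3P[_ _]].
by rewrite (disjointWl eD).
Qed.

Lemma densest_rhoE {R : realType} {V : finType} (G : wgraph R V) (B : {set V}) :
  total_weight G (touching G (densest G B :|: B) (densest G B)) =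
  local_rho G B (densest G B) * #|densest G B|%:R.
Proof.
(* The default [set0], taken when [B] is the whole vertex set, makes both sides 0. *)
rewrite -local_edgesE /local_rho; have [S0|S0] := eqVneq (densest G B) set0.
  by rewrite local_edgesE S0 cards0 touching0 mulr0 /total_weight big_set0.
by rewrite divfK // pnatr_eq0 cards_eq0.
Qed.

(** Maximality with the denominator cleared, which also admits an empty [Y]. *)
Lemma le_densest_rho {R : realType} {V : finType} (G : wgraph R V) (B Y : {set V}) :
  Y \subset ~: B ->
  total_weight G (touching G (Y :|: B) Y) <=
  local_rho G B (densest G B) * #|Y|%:R.
Proof.
move=> YB; have [->|Y0] := eqVneq Y set0.
  by rewrite touching0 cards0 mulr0 /total_weight big_set0.
have BT : B != setT.
  by apply: contra Y0 => /eqP BT; move: YB; rewrite BT setCT subset0.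
have /maxsetp/andP[_ /forallP/(_ Y)] := densestP G BT.
rewrite /candidate Y0 YB /= {1}/local_rho ler_pdivrMr ?ltr0n ?card_gt0 //.
by rewrite local_edgesE.
Qed.

Lemma local_rho_ge0 {R : realType} {V : finType} (G : wgraph R V) (B X : {set V}) :
  0 <= local_rho G B X.
Proof.
rewrite divr_ge0 // sumr_ge0 // => e; rewrite inE => /andP[eE _].
exact: ltW (weight_gt0 eE).
Qed.

Lemma disjoint_densest {R : realType} {V : finType} (G : wgraph R V) (B : {set V}) :
  [disjoint B & densest G B].
Proof. by rewrite disjoint_sym disjoints_subset densest_sub. Qed.

(** If the next layer [S'] were denser than [S], then [S :|: S'] would have larger density over [B]
    than [S], against maximality. *)
Lemma densest_rho_decr {R : realType} {V : finType} (G : wgraph R V) (B : {set V}) :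
  local_rho G (B :|: densest G B) (densest G (B :|: densest G B)) <=
  local_rho G B (densest G B).
Proof.
have SB := densest_sub G B; have wS := densest_rhoE G B.
have hmax := le_densest_rho G B.
move: (densest G B) SB wS hmax => S SB wS hmax.
have dS' := disjoint_densest G (B :|: S); have wS' := densest_rhoE G (B :|: S).
move: (densest G (B :|: S)) dS' wS' => S' dS' wS'.
(* Once the vertices are exhausted [S'] is empty, and its density is 0 because the inverse of 0 is
   0. *)
have [->|S'0] := eqVneq S' set0.
  by rewrite {1}/local_rho cards0 invr0 mulr0 local_rho_ge0.
have dSS' : [disjoint S & S'] by apply: disjointWl dS'; exact: subsetUr.
have SS'B : S :|: S' \subset ~: B.
  rewrite subUset SB /= -disjoints_subset disjoint_sym.
  by apply: disjointWl dS'; exact: subsetUl.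
have dSB : [disjoint S :|: B & S'] by rewrite setUC.
have sub : S :|: B \subset S :|: S' :|: B by rewrite setUAC subsetUl.
have := le_trans (touching_setU G _ _ S S' sub dSB) (hmax _ SS'B).
rewrite [S :|: S' :|: B]setUC setUA [_ :|: S']setUC wS wS'.
rewrite cardsU disjoint_setI0 // cards0 subn0 natrD mulrDr lerD2l ler_pM2r //.
by rewrite ltr0n card_gt0.
Qed.

Lemma layer_rho_decr {R : realType} {V : finType} (G : wgraph R V) (i j : nat) :
  (i <= j)%N ->
  local_rho G (below G j) (layer G j) <= local_rho G (below G i) (layer G i).
Proof.
elim: j => [|j IHj]; first by rewrite leqn0 => /eqP ->.
rewrite leq_eqVlt => /orP[/eqP -> //|/IHj]; apply: le_trans.
exact: densest_rho_decr.
Qed.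

(** The edges counted for the layer either meet [Y] or are counted for the layer minus [Y]. By
    maximality the latter weigh at most the density times the number of remaining vertices. *)
Lemma densest_removal {R : realType} {V : finType} (G : wgraph R V) (B Y : {set V}) :
  Y \subset densest G B ->
  local_rho G B (densest G B) * #|Y|%:R <=
  total_weight G (touching G (densest G B :|: B) Y).
Proof.
set S := densest G B => YS.
have SY : S :\: Y \subset ~: B.
  by apply: subset_trans (densest_sub G B); exact: subsetDl.
have h1 := le_densest_rho G B _ SY.
have h2 := densest_rhoE G B.
have h3 : total_weight G (touching G (S :|: B) S) <=
   total_weight G (touching G (S :\: Y :|: B) (S :\: Y)) +
   total_weight G (touching G (S :|: B) Y).
  rewrite -total_weightU.
    apply: total_weight_sub; last by rewrite subUset !touching_edges.
    apply/subsetP => e; rewrite !inE => /and3P[-> eD eS] /=; rewrite eD /=.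
    case eY: [disjoint e & Y]; rewrite ?orbT //= orbF; apply/andP; split.
      apply/subsetP => x xe; have := subsetP eD x xe; rewrite !inE.
      by rewrite (disjointFr eY xe).
    apply: contra eS => /pred0P H; apply/pred0P => x /=; have := H x; rewrite /= inE.
    by case xe: (x \in e) => //=; rewrite (disjointFr eY xe).
  apply/pred0P => e /=; rewrite !inE; apply/negP => /andP[/and3P[_ eD _] /and3P[_ _]].
  case/pred0Pn => x /andP[/= xe xY]; have := subsetP eD x xe; rewrite !inE xY /=.
  by apply/negP; have := subsetP (densest_sub G B) x (subsetP YS x xY); rewrite inE.
have cS : #|S|%:R = #|S :\: Y|%:R + #|Y|%:R :> R.
  by rewrite -natrD -(cardsID Y S) (setIidPr YS) addnC.
rewrite h2 -/S cS mulrDr in h3; lra.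
Qed.

(** Induction on layers: [densest_removal] handles the part of [Y] in the last layer, and edges
    inside the earlier layers do not meet that part. *)
Lemma below_removal {R : realType} {V : finType} (G : wgraph R V) (j : nat)
    (c : R) (Y : {set V}) :
  (forall i, (i < j)%N -> c <= local_rho G (below G i) (layer G i)) ->
  Y \subset below G j ->
  c * #|Y|%:R <= total_weight G (touching G (below G j) Y).
Proof.
elim: j Y => [|j IHj] Y hc YD.
  move: YD; rewrite subset0 => /eqP ->.
  by rewrite cards0 mulr0 touching0 /total_weight big_set0.
have E : below G j.+1 = layer G j :|: below G j by rewrite belowS setUC.
have YE : Y = (Y :&: below G j) :|: (Y :&: layer G j).
  by rewrite -setIUr -belowS (setIidPl YD).
have dj : [disjoint below G j & Y :&: layer G j].
  by apply: disjointWr (disjoint_densest G _); exact: subsetIr.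
have cY : #|Y|%:R = #|Y :&: below G j|%:R + #|Y :&: layer G j|%:R :> R.
  have dY : [disjoint Y :&: below G j & Y :&: layer G j].
    by apply: disjointWl dj; exact: subsetIr.
  by rewrite {1}YE cardsU (disjoint_setI0 dY) cards0 subn0 natrD.
have h1 := IHj (Y :&: below G j) (fun i ij => hc i (ltnW ij)) (subsetIr _ _).
have h2 := densest_removal G (below G j) (Y :&: layer G j) (subsetIr _ _).
have := touching_setU G (below G j) (below G j.+1) (Y :&: below G j) _
  (below_mono G (leqnSn j)) dj.
rewrite -YE cY mulrDr; apply: le_trans; rewrite lerD //.
rewrite E; apply: le_trans h2; rewrite ler_wpM2r //.
exact: hc (leqnn _).
Qed.

(** * Edge weights against out-degrees *)

(** Each edge comes from exactly two ordered pairs, whose shares add up to its weight. *)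
Lemma total_weight_pairs {R : realType} {V : finType} (G : wgraph R V)
    (o : V -> V -> R) (F : {set {set V}}) :
  fractional_orientation G o -> F \subset edges G ->
  total_weight G F = \sum_(p : V * V | [set p.1; p.2] \in F) o p.1 p.2.
Proof.
move=> oG /subsetP FE; rewrite /total_weight.
rewrite [RHS](partition_big (fun p : V * V => [set p.1; p.2]) (mem F)) //=.
apply: eq_bigr => e eF; have eE := FE e eF.
have /cards2P[a [b [ab Ee]]] := introT eqP (card_edge eE).
rewrite Ee in eE; have [_ oE] := oG a b eE; rewrite {1}Ee -oE.
have ba : (b, a) != (a, b) by rewrite xpair_eqE negb_and eq_sym ab.
rewrite (bigD1 (a, b)) /=; last by rewrite -Ee eF eqxx.
rewrite (bigD1 (b, a)) /=; last by rewrite setUC -Ee eF eqxx ba.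
rewrite big1 ?addr0 ?Ee // => -[x y] /= /andP[/andP[/andP[_ /eqP Exy]] n1 n2].
have xe : x \in [set a; b] by rewrite -Exy set21.
have ye : y \in [set a; b] by rewrite -Exy set22.
have ae : a \in [set x; y] by rewrite Exy set21.
have be : b \in [set x; y] by rewrite Exy set22.
move: xe ye ae be n1 n2 ab; rewrite !inE !xpair_eqE.
move=> /orP[]/eqP-> /orP[]/eqP->; rewrite ?eqxx ?orbb //= ?andbT.
  by move=> _ /eqP->; rewrite eqxx.
by move=> /eqP->; rewrite eqxx.
Qed.

Lemma sum_outdeg_pairs {R : realType} {V : finType} (G : wgraph R V)
    (o : V -> V -> R) (X : {set V}) :
  \sum_(u in X) outdeg G o u =
  \sum_(p : V * V | (p.1 \in X) && ([set p.1; p.2] \in edges G)) o p.1 p.2.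
Proof. by rewrite /outdeg pair_big_dep. Qed.

(** Only positive terms need to pass from [P] to [Q]; this matches fairness, which constrains a pair
    only when [o u v] is positive. *)
Lemma ler_sum_support {R : realType} {I : finType} (P Q : pred I) (F : I -> R) :
  (forall i, P i -> 0 < F i -> Q i) -> (forall i, Q i -> 0 <= F i) ->
  \sum_(i | P i) F i <= \sum_(i | Q i) F i.
Proof.
move=> PQ Q0; rewrite [leLHS]big_mkcond [leRHS]big_mkcond; apply: ler_sum => i _.
case Pi: (P i); case Qi: (Q i) => //; last exact: Q0.
by rewrite leNgt; apply/negP => /(PQ i Pi); rewrite Qi.
Qed.

Lemma outdeg_ge0 {R : realType} {V : finType} (G : wgraph R V)
    (o : V -> V -> R) (u : V) :
  fractional_orientation G o -> 0 <= outdeg G o u.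
Proof. by move=> oG; rewrite sumr_ge0 // => w /oG[]. Qed.

Lemma outdeg_layer_step {R : realType} {V : finType} (G : wgraph R V)
    (eta : R) (o : V -> V -> R) (B T T' : {set V}) :
  fractional_orientation G o ->
  T \subset T' -> T' \subset ~: B ->
  (forall u w, [set u; w] \in edges G -> 0 < o u w -> u \in T -> w \in T' :|: B) ->
  \sum_(u in T) outdeg G o u <= local_rho G B (densest G B) * #|T'|%:R.
Proof.
move=> oG TT' T'B hT; apply: le_trans (le_densest_rho G B T' T'B).
rewrite sum_outdeg_pairs (total_weight_pairs _ _ _ oG (touching_edges _ _ _)).
apply: ler_sum_support => -[u w] /=.
  move=> /andP[uT uwE] ouw; have wT' := hT u w uwE ouw uT.
  have uT' := subsetP TT' u uT.
  rewrite inE uwE subUset !sub1set wT' inE uT' /=.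
  by apply/pred0Pn; exists u; rewrite /= set21.
by rewrite inE => /andP[/oG[]].
Qed.

(** A positive share of a touching edge has its tail or its head in [U]; in both cases the tail lies
    in [U']. *)
Lemma touching_outdeg {R : realType} {V : finType} (G : wgraph R V)
    (o : V -> V -> R) (D U U' : {set V}) :
  fractional_orientation G o -> U \subset U' ->
  (forall u w, [set u; w] \in edges G -> 0 < o u w ->
    u \in D -> w \in U -> u \in U') ->
  total_weight G (touching G D U) <= \sum_(u in U') outdeg G o u.
Proof.
move=> oG UU' hU.
rewrite sum_outdeg_pairs (total_weight_pairs _ _ _ oG (touching_edges _ _ _)).
apply: ler_sum_support => -[u w] /=; last by case/andP=> _ /oG[].
rewrite inE => /and3P[uwE]; rewrite subUset !sub1set => /andP[uD wD] touch ouw.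
rewrite uwE andbT; case/pred0Pn: touch => x /= /andP[]; rewrite !inE.
by move=> /orP[]/eqP-> xU; [exact: (subsetP UU')|exact: hU ouw uD xU].
Qed.

Lemma mem_layer_level {R : realType} {V : finType} (G : wgraph R V) (v : V) :
  v \in layer G (level G v).
Proof. by rewrite /level; case: ex_minnP. Qed.

Theorem theorem12 (R : realType) (V : finType) (G : wgraph R V)
    (eps eta : R) (o : V -> V -> R)
    (eps_gt0 : 0 < eps) (eps_le1 : eps <= 1) (eta_gt0 : 0 < eta)
    (o_orient : fractional_orientation G o) (o_fair : fair G o eta)
    (eta_le : (1 < #|V|)%N -> eta <= eps ^+ 2 / (128%:R * ln #|V|%:R))
    (v : V) :
  (1 + eps)^-1 * local_density G v <= outdeg G o v /\
  outdeg G o v <= (1 + eps) * local_density G v.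
Proof.
(* With at most one vertex there are no edges, and both quantities are 0. *)
have [V1|V1] := leqP #|V| 1.
  have noE e : e \in edges G = false.
    by apply/negP => /card_edge e2; have := max_card (mem e); rewrite e2 leqNgt ltnS V1.
  have -> : outdeg G o v = 0 by rewrite /outdeg big_pred0 // => w; rewrite noE.
  have -> : local_density G v = 0.
    by rewrite /local_density /local_rho big_pred0 ?mul0r // => e; rewrite inE noE.
  by rewrite !mulr0.
have e1 : 0 < 1 + eps by lra.
have h1 : 0 < 1 + eta by lra.
have h1n i : 0 < (1 + eta) ^+ i by rewrite exprn_gt0.
have gv0 := outdeg_ge0 G o v o_orient.
have vS := mem_layer_level G v.
have growth f := slow_growth _ _ _ f eps_gt0 eps_le1 eta_gt0 V1 (eta_le V1).
have rho0 : 0 <= local_density G v := local_rho_ge0 _ _ _.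
split.
  pose D := below G (level G v).+1.
  pose U i := [set w in D | outdeg G o w <= (1 + eta) ^+ i * outdeg G o v].
  have vU i : v \in U i.
    rewrite inE [D]belowS inE vS orbT /= ler_peMl // exprn_ege1 //; lra.
  have U0 i : (0 < #|U i|)%N by apply/card_gt0P; exists v.
  have [i Hi] := growth (fun i => #|U i|) (U0 0%N) (fun i => max_card _).
  have Ui0 : 0 < #|U i|%:R :> R by rewrite ltr0n.
  rewrite mulrC ler_pdivrMr //.
  rewrite -(ler_pM2r Ui0).
  (* Every layer making up [D] has index at most [level G v], hence density at least that of [v]. *)
  have low : local_density G v * #|U i|%:R <= total_weight G (touching G D (U i)).
    apply: below_removal; last by apply/subsetP => w; rewrite inE => /andP[].
    by move=> j; rewrite ltnS => /(layer_rho_decr G).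
  have UU : U i \subset U i.+1.
    apply/subsetP => w; rewrite !inE => /andP[-> /le_trans]; apply.
    rewrite exprS -mulrA ler_peMl //; [exact: mulr_ge0 (ltW (h1n i)) gv0|lra].
  have up : total_weight G (touching G D (U i)) <= \sum_(u in U i.+1) outdeg G o u.
    apply: touching_outdeg => // u w uwE ouw uD.
    rewrite [w \in _]inE [u \in U _]inE uD => /andP[_ gw] /=.
    apply: le_trans (o_fair u w uwE ouw) _.
    by rewrite exprS -mulrA ler_pM2l.
  have sum_le : \sum_(u in U i.+1) outdeg G o u <=
      #|U i.+1|%:R * ((1 + eta) ^+ i.+1 * outdeg G o v).
    rewrite mulr_natl -sumr_const; apply: ler_sum => u; rewrite inE => /andP[] //.
  apply: le_trans low (le_trans up (le_trans sum_le _)).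
  by rewrite mulrA mulrC -[leRHS]mulrA ler_wpM2l.
pose B := below G (level G v).
pose T i := [set w in ~: B | outdeg G o v <= (1 + eta) ^+ i * outdeg G o w].
have vT i : v \in T i.
  rewrite inE (subsetP (densest_sub G B)) //= ler_peMl // exprn_ege1 //; lra.
have T0 i : (0 < #|T i|)%N by apply/card_gt0P; exists v.
have [i Hi] := growth (fun i => #|T i|) (T0 0%N) (fun i => max_card _).
have Ti0 : 0 < #|T i|%:R :> R by rewrite ltr0n.
have TT : T i \subset T i.+1.
  apply/subsetP => w; rewrite !inE => /andP[-> /le_trans]; apply.
  rewrite exprS -mulrA ler_peMl //; last lra.
  exact: mulr_ge0 (ltW (h1n i)) (outdeg_ge0 _ _ _ o_orient).
have up : \sum_(u in T i) outdeg G o u <= local_density G v * #|T i.+1|%:R.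
  apply: outdeg_layer_step => //.
    by apply/subsetP => w; rewrite inE => /andP[].
  move=> u w uwE ouw; rewrite !inE => /andP[_ gu]; case: (w \in B) => //=.
  rewrite orbF; apply: le_trans gu _.
  by rewrite exprSr -mulrA ler_pM2l //; exact: o_fair.
have low : #|T i|%:R * outdeg G o v <=
    (1 + eta) ^+ i * \sum_(u in T i) outdeg G o u.
  rewrite mulr_natl -sumr_const mulr_sumr; apply: ler_sum => u.
  by rewrite inE => /andP[].
rewrite -(ler_pM2l Ti0); apply: le_trans low _.
(* The exponent is raised from [i] to [i.+1] to match [Hi]. *)
apply: le_trans (_ : (1 + eta) ^+ i.+1 * (local_density G v * #|T i.+1|%:R) <= _).
  apply: ler_pM up; rewrite ?(ltW (h1n i)) //.
    by rewrite sumr_ge0 // => u _; exact: outdeg_ge0.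
  by rewrite ler_weXn2l //; lra.
nra.
Qed.
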